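(* Let $L=L(q;p_1,\dots,p_n)$ be a lens space. Then $L$ is clean: for every $\tau\in\operatorname{spec}_{\mathcal L}(L)$, the fixed point set $\operatorname{Fix}(\Phi_\tau)\subset SL$ of the time-$\tau$ map of the geodesic flow is a finite disjoint union of closed submanifolds of $SL$, and for each $\theta\in\operatorname{Fix}(\Phi_\tau)$ one has $\ker(D_\theta\Phi_\tau-\mathrm{Id})=T_\theta\operatorname{Fix}(\Phi_\tau)$.
   Context: Lens spaces: let $S^{2n-1}$ carry the metric of constant sectional curvature $1$. Fix an integer $q>2$ and integers $p_1,\dots,p_n$ with $p_1=1$ and each $p_i$ relatively prime to $q$. Let $T\in\mathrm{SO}(2n)$ be the block diagonal matrix with $2\times2$ blocks $$\begin{pmatrix}\cos(2\pi p_i/q)&-\sin(2\pi p_i/q)\\ \sin(2\pi p_i/q)&\cos(2\pi p_i/q)\end{pmatrix},\qquad i=1,\dots,n.$$ $T$ generates a cyclic group of order $q$ acting freely by isometries on $S^{2n-1}$, and $L(q;p_1,\dots,p_n)=S^{2n-1}/\langle T\rangle$ with the quotient Riemannian metric. For a closed Riemannian manifold $M$, $SM$ is the unit tangent bundle, $\Phi_t:SM\to SM$ is the time-$t$ map of the geodesic flow, $D_\theta\Phi_\tau:T_\theta SM\to T_\theta SM$ is its differential at a fixed point $\theta$, and $\operatorname{spec}_{\mathcal L}(M)$ (the length spectrum) is the set of lengths of smoothly closed geodesics of $M$. *)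

(* Defs.v *)
From mathcomp Require Import all_boot all_order all_algebra.
From mathcomp Require Import all_classical all_reals all_analysis.

Set Implicit Arguments.
Unset Strict Implicit.
Unset Printing Implicit Defensive.

Import Order.TTheory GRing.Theory Num.Theory.
Import numFieldNormedType.Exports.

Local Open Scope classical_set_scope.
Local Open Scope ring_scope.

(* In finite dimension this is the usual class C^k on an open set U. *)
Fixpoint Ck (R : realType) (V W : normedModType R) (U : set V) (k : nat)
    (f : V -> W) : Prop :=
  if k is k'.+1 then
    (forall x, U x -> differentiable f x) /\
    (forall v, Ck U k' (fun x => 'D_v f x))
  else {in U, continuous f}.

Definition smooth_on (R : realType) (V W : normedModType R) (U : set V)
    (f : V -> W) : Prop :=
  forall k, Ck U k f.

Definition smooth_curve (R : realType) (V : normedModType R) (c : R -> V) :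
    Prop :=
  forall k t, derivable (derive1n k c) t 1.

(* The velocity vector of c at time t together with its foot point: the tangent
   bundle of a subset of 'M_(m, k) is a subset of 'M_(m, k + k), the left block
   being the foot point and the right block the vector.  A matrix of 'M_m acts
   by left multiplication on all these spaces at once, and its action on the
   tangent bundle is the differential of its action on the base. *)
Definition velocity (R : realType) (m k : nat) (c : R -> 'M[R]_(m, k)) (t : R) :
    'M[R]_(m, k + k) :=
  row_mx (c t) (derive1 c t).

Section EmbeddedSubmanifolds.
Context {R : realType} {m : nat}.

(* Embedded C^infty submanifolds of dimension d, without boundary: near each of
   its points A is the zero set of a smooth map g to R^c, c being the
   codimension, that is a submersion at that point. *)
Definition submanifold (k d : nat) (A : set 'M[R]_(m, k)) : Prop :=
  forall z, A z ->
    exists (c : nat) (U : set 'M[R]_(m, k)) (g : 'M[R]_(m, k) -> 'cV[R]_c),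
      [/\ (d + c = m * k)%N, open U /\ U z, smooth_on U g,
          (forall w, exists v, 'd g z v = w) &
          U `&` A = U `&` g @^-1` [set 0]].

Definition curve_in (k : nat) (A : set 'M[R]_(m, k)) (c : R -> 'M[R]_(m, k)) :
    Prop :=
  smooth_curve c /\ forall t, A (c t).

Definition tangent_space (k : nat) (A : set 'M[R]_(m, k)) (z : 'M[R]_(m, k)) :
    set 'M[R]_(m, k) :=
  [set v | exists c, [/\ curve_in A c, c 0 = z & derive1 c 0 = v]].

Definition dot (u v : 'cV[R]_m) : R := \sum_(i < m) u i 0 * v i 0.

Definition unit_tangent_bundle (N : set 'cV[R]_m) : set 'M[R]_(m, 1 + 1) :=
  [set z | let x := lsubmx z in let v := rsubmx z in
           [/\ N x, tangent_space N x v & dot v v = 1]].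

(* Geodesics of N for the metric induced by the Euclidean one: the covariant
   derivative of c' along c is the orthogonal projection of c'' to the tangent
   space of N, so that c is a geodesic iff c'' is normal to N. *)
Definition geodesic (N : set 'cV[R]_m) (c : R -> 'cV[R]_m) : Prop :=
  curve_in N c /\
  forall t w, tangent_space N (c t) w -> dot (derive1n 2 c t) w = 0.

End EmbeddedSubmanifolds.

Definition unit_sphere (R : realType) (m : nat) : set 'cV[R]_m :=
  [set x | dot x x = 1].

Arguments unit_sphere : clear implicits.

(* A closed Riemannian manifold M = N / G is given here by a compact embedded
   submanifold N of R^m with the induced metric, and a finite group G of
   orthogonal matrices that preserves N and acts freely on it; M carries the
   quotient metric.  These properties of N and G are not part of the
   definitions below.
   The points of a quotient are orbits; besides M itself we need
     SM = (unit_tangent_bundle N) / G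
   and its tangent bundle T(SM) = T(unit_tangent_bundle N) / G.  As the
   projections to the quotients are coverings (locally isometric ones for
   N -> M), smooth curves and geodesics of a quotient are exactly the
   projections of those upstairs, and a subset of a quotient is a submanifold
   iff its preimage is one; the preimage, lying in the submanifold
   unit_tangent_bundle N of 'M_(m, 1 + 1), may equivalently be regarded as a
   submanifold of 'M_(m, 1 + 1). *)
Section Quotients.
Context {R : realType} {m : nat}.
Variables (N : set 'cV[R]_m) (G : set 'M[R]_m).

Definition orb (k : nat) (z : 'M[R]_(m, k)) : set 'M[R]_(m, k) :=
  [set g *m z | g in G].

Definition SM : set (set 'M[R]_(m, 1 + 1)) :=
  [set orb z | z in unit_tangent_bundle N].

(* The geodesic flow on SM: the velocity at time 0 of a geodesic of M is sent
   to its velocity at time t. *)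
Definition geodesic_flow (t : R) (theta : set 'M[R]_(m, 1 + 1)) :
    set 'M[R]_(m, 1 + 1) :=
  xget set0 [set theta' | exists c : R -> 'cV[R]_m,
    [/\ geodesic N c, orb (velocity c 0) = theta &
        orb (velocity c t) = theta']].

Definition curve_length (c : R -> 'cV[R]_m) (b : R) : R :=
  \int[lebesgue_measure]_(t in `[0, b])
    Num.sqrt (dot (derive1 c t) (derive1 c t)).

(* Lengths of the nonconstant geodesics [0, b] -> M that close up smoothly,
   i.e. whose velocities in TM at the times 0 and b agree. *)
Definition length_spectrum : set R :=
  [set tau | 0 < tau /\ exists (c : R -> 'cV[R]_m) (b : R),
    [/\ 0 < b, geodesic N c, orb (velocity c b) = orb (velocity c 0) &
        curve_length c b = tau]].

Definition fixed_set (tau : R) : set (set 'M[R]_(m, 1 + 1)) :=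
  [set theta | SM theta /\ geodesic_flow tau theta = theta].

(* Closed means compact without boundary; the preimage of F under the finite
   covering onto the quotient is compact iff F is. *)
Definition closed_submanifold (F : set (set 'M[R]_(m, 1 + 1))) : Prop :=
  F `<=` SM /\
  let preF := [set z | F (orb z)] in
  compact preF /\ exists d, submanifold d preF.

(* The tangent vectors at theta of a subset A of SM: the velocities in T(SM) of
   the smooth curves of SM that lie in A. *)
Definition quotient_tangent_space (A : set (set 'M[R]_(m, 1 + 1)))
    (theta : set 'M[R]_(m, 1 + 1)) :
    set (set 'M[R]_(m, (1 + 1) + (1 + 1))) :=
  [set X | exists c, [/\ curve_in [set z | A (orb z)] c,
                         orb (c 0) = theta & orb (velocity c 0) = X]].

(* The differential of f : SM -> SM, which sends the velocity at time 0 of a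
   curve of SM to that of its image under f. *)
Definition differential (f : set 'M[R]_(m, 1 + 1) -> set 'M[R]_(m, 1 + 1))
    (X : set 'M[R]_(m, (1 + 1) + (1 + 1))) :
    set 'M[R]_(m, (1 + 1) + (1 + 1)) :=
  xget set0 [set Y | exists c e : R -> 'M[R]_(m, 1 + 1),
    [/\ curve_in (unit_tangent_bundle N) c, smooth_curve e,
        (forall t, orb (e t) = f (orb (c t))),
        orb (velocity c 0) = X & orb (velocity e 0) = Y]].

(* ker (D_theta f - Id), for a fixed point theta of f. *)
Definition ker_differential_sub_id
    (f : set 'M[R]_(m, 1 + 1) -> set 'M[R]_(m, 1 + 1))
    (theta : set 'M[R]_(m, 1 + 1)) : set (set 'M[R]_(m, (1 + 1) + (1 + 1))) :=
  [set X | quotient_tangent_space SM theta X /\ differential f X = X].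

Definition clean : Prop :=
  forall tau, length_spectrum tau ->
    (exists (k : nat) (F : 'I_k -> set (set 'M[R]_(m, 1 + 1))),
      [/\ fixed_set tau = \bigcup_i F i, trivIset setT F &
          forall i, closed_submanifold (F i)]) /\
    (forall theta, fixed_set tau theta ->
      ker_differential_sub_id (geodesic_flow tau) theta =
      quotient_tangent_space (fixed_set tau) theta).

End Quotients.

Definition rotation (R : realType) (a : R) : 'M[R]_2 :=
  block_mx (cos a)%:M (- sin a)%:M (sin a)%:M (cos a)%:M : 'M[R]_(1 + 1).

(* \sum_(i < n) 2 = 2n is the size of a block matrix with n blocks of size 2. *)
Definition lens_generator (R : realType) (n q : nat) (p : 'I_n -> int) :
    'M[R]_(\sum_(i < n) 2) :=
  \mxdiag_(i < n) rotation (2 * pi * (p i)%:~R / q%:R).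

(* Nonnegative powers suffice, as the generator has finite order. *)
Definition lens_group (R : realType) (n q : nat) (p : 'I_n -> int) :
    set 'M[R]_(\sum_(i < n) 2) :=
  [set lens_generator R q p ^+ k | k in [set: nat]].

Arguments lens_group R {n} q p.

(* Main.v *)
Require Import Defs.
From mathcomp Require Import all_boot all_order all_algebra.
From mathcomp Require Import all_classical all_reals all_analysis.
From mathcomp Require Import ring lra.

(* The unit tangent bundle U of the sphere consists of the matrices z = [x v]
   with orthonormal columns; the geodesic flow is z |-> z K_t with K_t a planar
   rotation, and it commutes with the deck group generated by T.  Hence
   Fix(Phi_tau) lifts to the union over k < q of the sets
   F_k = {z in U | T^k z = z K_tau}, which are pairwise disjoint because the
   action is free.
   If sin tau <> 0, comparing Gram matrices shows that every z = [x v] with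
   T^k z = z K_tau satisfies |x| = |v| and x orthogonal to v, so that F_k is the
   unit sphere of a linear space, and great circles in that sphere realize the
   linearized fixed point equation T^k w = w K_tau.  If sin tau = 0, then K_tau
   is 1 or -1, and freeness forces T^k to be the same sign as soon as F_k is
   nonempty, so that F_k is empty or all of U. *)

Set Implicit Arguments.
Unset Strict Implicit.
Unset Printing Implicit Defensive.

Import Order.TTheory GRing.Theory Num.Theory.
Import numFieldNormedType.Exports.

Local Open Scope classical_set_scope.
Local Open Scope ring_scope.

(** * Differential calculus of matrix-valued curves and polynomial maps *)

Section MatrixCalculus.
Context {R : realType}.

Lemma differentiable_fun_sum (V W : normedModType R) (I : Type) (r : seq I)
    (F : I -> V -> W) x :
  (forall i, differentiable (F i) x) ->
  differentiable (fun z => \sum_(i <- r) F i z) x.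
Proof.
move=> dF; elim: r => [|i r IHr].
  by under eq_fun do rewrite big_nil; exact: differentiable_cst.
under eq_fun do rewrite big_cons.
by apply: differentiableD.
Qed.

Lemma linear_mx_continuous m n (W : normedModType R)
    (f : {linear 'M[R]_(m, n) -> W}) : continuous f.
Proof.
have -> : f = (fun z => \sum_i \sum_j z i j *: f (delta_mx i j)) :> (_ -> _).
  apply/funext => z; rewrite [in LHS](matrix_sum_delta z) linear_sum.
  apply: eq_bigr => i _; rewrite linear_sum.
  by apply: eq_bigr => j _; rewrite linearZ.
move=> z; apply: differentiable_continuous.
apply: differentiable_fun_sum => i; apply: differentiable_fun_sum => j.
exact/differentiableZl/differentiable_coord.
Qed.

Lemma derivable_linear_mx m n (W : normedModType R)
    (f : {linear 'M[R]_(m, n) -> W}) (c : R -> 'M[R]_(m, n)) t :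
  derivable c t 1 ->
  derivable (f \o c) t 1 /\ derive1 (f \o c) t = f (derive1 c t).
Proof.
move=> /derivable1_diffP dc.
have df : differentiable f (c t).
  exact/linear_differentiable/linear_mx_continuous.
split; first exact/derivable1_diffP/differentiable_comp.
rewrite !derive1E'//; last exact: differentiable_comp.
by rewrite diff_comp//= diff_lin//; exact: linear_mx_continuous.
Qed.

Lemma derive1_mxE m n (c : R -> 'M[R]_(m, n)) t i j : derivable c t 1 ->
  derivable (fun s => c s i j) t 1 /\
  derive1 (fun s => c s i j) t = derive1 c t i j.
Proof.
move=> dc; split; first by move/derivable_mxP : dc.
by rewrite !derive1E derive_mx// mxE.
Qed.

(** The equations that cut out the fixed point sets are polynomial in the matrix entries. This class
    is stable under directional derivatives, so smoothness follows by induction on the order. *)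
Inductive polyfun m n : ('M[R]_(m, n) -> R) -> Prop :=
| polyfun_cst a : polyfun (fun=> a)
| polyfun_coord i j : polyfun (fun z => z i j)
| polyfun_add f g : polyfun f -> polyfun g -> polyfun (fun z => f z + g z)
| polyfun_mul f g : polyfun f -> polyfun g -> polyfun (fun z => f z * g z).

Lemma polyfun_sum m n (I : Type) (r : seq I) (P : pred I)
    (F : I -> 'M[R]_(m, n) -> R) :
  (forall i, polyfun (F i)) -> polyfun (fun z => \sum_(i <- r | P i) F i z).
Proof.
move=> PF; elim: r => [|i r IHr].
  by under eq_fun do rewrite big_nil; exact: polyfun_cst.
under eq_fun do rewrite big_cons.
by case: (P i) => //; exact: polyfun_add.
Qed.

Lemma polyfun_derive m n (f : 'M[R]_(m, n) -> R) : polyfun f ->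
  (forall z, differentiable f z) /\ (forall v, polyfun ('D_v f)).
Proof.
elim=> {f} [a|i j|f g Pf [df Df] Pg [dg Dg]|f g Pf [df Df] Pg [dg Dg]].
- split=> [z|v]; first exact: differentiable_cst.
  have -> : 'D_v (fun=> a) = (fun=> 0) :> ('M[R]_(m, n) -> R).
    by apply/funext => z; rewrite derive_cst.
  exact: polyfun_cst.
- split=> [z|v]; first exact: differentiable_coord.
  have -> : 'D_v (fun z : 'M[R]_(m, n) => z i j) = (fun=> v i j)
      :> ('M[R]_(m, n) -> R).
    apply/funext => z; transitivity ('D_v (@id 'M[R]_(m, n)) z i j).
      by rewrite derive_mx ?mxE//; exact: derivable_id.
    by rewrite derive_id.
  exact: polyfun_cst.
- split=> [z|v]; first by apply: differentiableD.
  have -> : 'D_v (fun z => f z + g z) = (fun z => 'D_v f z + 'D_v g z).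
    by apply/funext => z; apply: deriveD; exact: diff_derivable.
  exact: polyfun_add.
- split=> [z|v]; first by apply: differentiableM.
  have -> : 'D_v (fun z => f z * g z) =
      (fun z => f z * 'D_v g z + g z * 'D_v f z).
    by apply/funext => z; apply: deriveM; exact: diff_derivable.
  by apply: polyfun_add; exact: polyfun_mul.
Qed.

Definition polymap m n k l (f : 'M[R]_(m, n) -> 'M[R]_(k, l)) :=
  forall i j, polyfun (fun z => f z i j).

Lemma polymap_differentiable m n k l (f : 'M[R]_(m, n) -> 'M[R]_(k, l)) z :
  polymap f -> differentiable f z.
Proof.
move=> Pf.
have -> : f = (fun z => \sum_i \sum_j f z i j *: delta_mx i j).
  by apply/funext => w; exact: matrix_sum_delta.
apply: differentiable_fun_sum => i; apply: differentiable_fun_sum => j.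
by apply: differentiableZl; have [] := polyfun_derive (Pf i j).
Qed.

Lemma polymap_continuous m n k l (f : 'M[R]_(m, n) -> 'M[R]_(k, l)) :
  polymap f -> continuous f.
Proof.
by move=> Pf z; exact/differentiable_continuous/polymap_differentiable.
Qed.

Lemma polymap_derive m n k l (f : 'M[R]_(m, n) -> 'M[R]_(k, l)) v :
  polymap f -> polymap ('D_v f).
Proof.
move=> Pf i j.
have -> : (fun z => 'D_v f z i j) = 'D_v (fun z => f z i j).
  apply/funext => z; rewrite derive_mx ?mxE//.
  exact/diff_derivable/polymap_differentiable.
by have [_] := polyfun_derive (Pf i j).
Qed.

Lemma polymap_smooth m n k l (f : 'M[R]_(m, n) -> 'M[R]_(k, l)) U :
  polymap f -> smooth_on U f.
Proof.
move=> Pf k'; elim: k' f Pf => [|k' IH] f Pf /=.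
  by move=> z _; exact: polymap_continuous.
split=> [z _|v]; first exact: polymap_differentiable.
by apply: IH; exact: polymap_derive.
Qed.

(** For [h] nonzero the difference quotient is [l + h *: b], which tends to [l]. The defining
    equations below are at most quadratic, so their differentials can be read off from such an
    expansion. *)
Lemma derive_quadratic (V W : normedModType R) (f : V -> W) (z v : V) l b :
  (forall h, f (h *: v + z) = f z + h *: l + h ^+ 2 *: b) -> 'D_v f z = l.
Proof.
move=> fE; apply/cvg_lim => //.
apply: (@cvg_trans _ ((fun h => l + h *: b) @ 0^')).
  apply: near_eq_cvg; near=> h.
  have h0 : h != 0 by near: h; exact: nbhs_dnbhs_neq.
  rewrite /= fE -(addrA (f z)) (addrC (f z)) addrK scalerDr !scalerA.
  by rewrite mulVf// scale1r expr2 mulKf.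
have : (fun h : R => l + h *: b) @ 0^' --> l + 0 *: b.
  apply: cvgD; first exact: cvg_cst.
  by apply: cvgZr_tmp; exact: cvg_within.
by rewrite scale0r addr0.
Unshelve. all: by end_near. Qed.

End MatrixCalculus.

(** * The Euclidean inner product *)

Section Dot.
Context {R : realType} {m : nat}.
Implicit Types u v w : 'cV[R]_m.

Lemma dotE u v : dot u v = (u^T *m v) 0 0.
Proof. by rewrite mxE; apply: eq_bigr => i _; rewrite mxE. Qed.

Lemma dotC u v : dot u v = dot v u.
Proof. by apply: eq_bigr => i _; rewrite mulrC. Qed.

Lemma dotDr u v w : dot u (v + w) = dot u v + dot u w.
Proof. by rewrite !dotE mulmxDr mxE. Qed.

Lemma dotDl u v w : dot (u + v) w = dot u w + dot v w.
Proof. by rewrite dotC dotDr !(dotC w). Qed.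

Lemma dotZr a u v : dot u (a *: v) = a * dot u v.
Proof. by rewrite !dotE -scalemxAr mxE. Qed.

Lemma dotZl a u v : dot (a *: u) v = a * dot u v.
Proof. by rewrite dotC dotZr dotC. Qed.

Lemma dot_eq0 u : dot u u = 0 -> u = 0.
Proof.
move=> /eqP; rewrite /dot psumr_eq0 => [/allP u0|i _]; last first.
  by rewrite -expr2 sqr_ge0.
apply/colP => i; rewrite mxE; apply/eqP.
by have := u0 i (mem_index_enum i); rewrite -expr2 sqrf_eq0.
Qed.

Lemma dot_ge0 u : 0 <= dot u u.
Proof. by apply: sumr_ge0 => i _; rewrite -expr2 sqr_ge0. Qed.

Lemma dot_mulmx (A : 'M[R]_m) u v : A^T *m A = 1%:M ->
  dot (A *m u) (A *m v) = dot u v.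
Proof. by move=> AA; rewrite !dotE trmx_mul -mulmxA (mulmxA A^T) AA mul1mx. Qed.

Lemma derive1_dot (c d : R -> 'cV[R]_m) t :
  derivable c t 1 -> derivable d t 1 ->
  derivable (fun s => dot (c s) (d s)) t 1 /\
  derive1 (fun s => dot (c s) (d s)) t =
    dot (derive1 c t) (d t) + dot (c t) (derive1 d t).
Proof.
move=> dc dd.
have E : (fun s => dot (c s) (d s)) =
    \sum_i (fun s => c s i 0) * (fun s => d s i 0).
  by apply/funext => s; rewrite fct_sumE.
have dci i := (derive1_mxE i 0 dc); have ddi i := (derive1_mxE i 0 dd).
have dE i : derivable ((fun s => c s i 0) * (fun s => d s i 0)) t 1.
  by apply: derivableM; [have [] := dci i|have [] := ddi i].
rewrite E; split; first exact: derivable_sum.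
rewrite derive1E derive_sum// -big_split/=; apply: eq_bigr => i _.
rewrite (deriveM (dci i).1 (ddi i).1) -!derive1E (dci i).2 (ddi i).2.
by rewrite [RHS]addrC; congr (_ + _); exact: mulrC.
Qed.

End Dot.

(** * Trigonometric curves and the harmonic oscillator *)

Section Trigonometric.
Context {R : realType}.

Lemma is_derive_trig (w a b t : R) :
  is_derive t 1 (fun s => cos (w * s) * a + sin (w * s) * b)
    (cos (w * t) * (w * b) + sin (w * t) * (- w * a)).
Proof.
have dw : is_derive t (1 : R) ( *%R w) w.
  by apply: (is_derive_eq (is_deriveZ w (is_derive_id t (1 : R))));
    exact: mulr1.
have dc : is_derive t 1 (fun s => cos (w * s)) (- sin (w * t) * w).
  exact: (@is_derive1_comp R cos ( *%R w)).
have ds : is_derive t 1 (fun s => sin (w * s)) (cos (w * t) * w).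
  exact: (@is_derive1_comp R sin ( *%R w)).
have := is_deriveD (is_deriveM dc (is_derive_cst a t (1 : R)))
  (is_deriveM ds (is_derive_cst b t (1 : R))).
by move/is_derive_eq; apply; rewrite /GRing.scale /= /cst; ring.
Qed.

(** For a fixed frequency [w] this family is stable under differentiation, which gives smoothness at
    once. With one column it provides great circles of the sphere, with two columns curves in the
    unit tangent bundle. *)
Definition circ m k (w : R) (a b : 'M[R]_(m, k)) (t : R) : 'M[R]_(m, k) :=
  cos (w * t) *: a + sin (w * t) *: b.

Lemma circ0 m k w (a b : 'M[R]_(m, k)) : circ w a b 0 = a.
Proof. by rewrite /circ mulr0 cos0 sin0 scale0r addr0 scale1r. Qed.

Lemma derive1_circ m k w (a b : 'M[R]_(m, k)) t :
  derivable (circ w a b) t 1 /\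
  derive1 (circ w a b) t = circ w (w *: b) (- w *: a) t.
Proof.
have E i j : (fun s => circ w a b s i j) =
    (fun s => cos (w * s) * a i j + sin (w * s) * b i j).
  by apply/funext => s; rewrite !mxE.
have dc : derivable (circ w a b) t 1.
  apply/derivable_mxP => i j; rewrite E.
  by have [] := is_derive_trig w (a i j) (b i j) t.
split=> //; rewrite derive1E derive_mx//; apply/matrixP => i j.
by rewrite mxE E; have [_ ->] := is_derive_trig w (a i j) (b i j) t;
  rewrite !mxE.
Qed.

Lemma smooth_circ m k w (a b : 'M[R]_(m, k)) : smooth_curve (circ w a b).
Proof.
have E n : exists a' b', derive1n n (circ w a b) = circ w a' b'.
  elim: n => [|n [a' [b' IH]]]; first by exists a, b.
  exists (w *: b'), (- w *: a'); rewrite derive1nS IH.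
  by apply/funext => t; have [] := derive1_circ w a' b' t.
by move=> n t; have [a' [b' ->]] := E n; have [] := derive1_circ w a' b' t.
Qed.

(** Rotating the pair of [f] and its derivative back by the angle [t] gives two functions with zero
    derivative, hence constants; inverting the rotation gives the formulas. *)
Lemma harmonic_oscillator (f : R -> R) (t : R) :
  (forall s, derivable f s 1) -> (forall s, derivable (derive1 f) s 1) ->
  (forall s, derive1n 2 f s = - f s) ->
  f t = cos t * f 0 + sin t * derive1 f 0 /\
  derive1 f t = - sin t * f 0 + cos t * derive1 f 0.
Proof.
move=> df ddf f2.
have dfP s : is_derive s (1 : R) f (derive1 f s).
  by rewrite derive1E; exact: derivableP.
have ddfP s : is_derive s (1 : R) (derive1 f) (- f s).
  by rewrite -f2 derive1nS derive1n1 derive1E; exact: derivableP.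
have dA s : is_derive s (1 : R) (cos * f - sin * derive1 f) 0.
  have := is_deriveB (is_deriveM (is_derive_cos s) (dfP s))
    (is_deriveM (is_derive_sin s) (ddfP s)).
  by move/is_derive_eq; apply; rewrite /GRing.scale /=; ring.
have dB s : is_derive s (1 : R) (sin * f + cos * derive1 f) 0.
  have := is_deriveD (is_deriveM (is_derive_sin s) (dfP s))
    (is_deriveM (is_derive_cos s) (ddfP s)).
  by move/is_derive_eq; apply; rewrite /GRing.scale /=; ring.
have A : cos t * f t - sin t * derive1 f t = f 0.
  have <- : cos 0 * f 0 - sin 0 * derive1 f 0 = f 0 by rewrite cos0 sin0; ring.
  exact: (@is_derive_0_is_cst _ _ t 0 dA).
have B : sin t * f t + cos t * derive1 f t = derive1 f 0.
  have <- : sin 0 * f 0 + cos 0 * derive1 f 0 = derive1 f 0.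
    by rewrite cos0 sin0; ring.
  exact: (@is_derive_0_is_cst _ _ t 0 dB).
have cs := cos2Dsin2 t; rewrite -A -B; split.
  by rewrite -[LHS]mul1r -cs; ring.
by rewrite -[LHS]mul1r -cs; ring.
Qed.

End Trigonometric.

(* On the unit tangent bundle of the sphere, whose points are the matrices
   [row_mx x v], the geodesic flow is right multiplication by [flow_mx t]. *)
Definition flow_mx (R : realType) (t : R) : 'M[R]_(1 + 1) :=
  block_mx (cos t)%:M (- sin t)%:M (sin t)%:M (cos t)%:M.

(** * Unit tangent bundle and geodesics of the round sphere *)

Section Sphere.
Context {R : realType} {m : nat}.
Implicit Types (x v : 'cV[R]_m) (z : 'M[R]_(m, 1 + 1)).
Local Notation S := (unit_sphere R m).

Lemma smooth_derivable m' k (c : R -> 'M[R]_(m', k)) t :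
  smooth_curve c -> derivable c t 1.
Proof. by move=> sc; exact: (sc 0). Qed.

(* For [v = 0] the frequency vanishes and [circ] is constant, whatever the junk
   value [0^-1] is. *)
Lemma great_circle x v (w := Num.sqrt (dot v v)) :
  dot x x = 1 -> dot x v = 0 ->
  w *: (w^-1 *: v) = v /\
  forall t, dot (circ w x (w^-1 *: v) t) (circ w x (w^-1 *: v) t) = 1.
Proof.
move=> xx xv; have w2 : w ^+ 2 = dot v v by rewrite sqr_sqrtr// dot_ge0.
have [w0|w0] := eqVneq w 0.
  have v0 : v = 0 by apply: dot_eq0; rewrite -w2 w0 expr0n.
  rewrite v0 !scaler0; split=> // t.
  by rewrite /circ w0 mul0r cos0 scale1r scaler0 addr0.
split=> [|t]; first by rewrite scalerA divff// scale1r.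
rewrite /circ !(dotDl, dotDr, dotZl, dotZr) (dotC v) xx xv -w2.
rewrite -[RHS](cos2Dsin2 (w * t)); field.
exact: w0.
Qed.

Lemma sphere_curve_orthogonal (c : R -> 'cV[R]_m) t :
  curve_in S c -> dot (c t) (derive1 c t) = 0.
Proof.
move=> [/smooth_derivable-/(_ t) dc Sc].
have [_] := derive1_dot dc dc.
rewrite (_ : (fun s => _) = cst 1); last by apply/funext => s; exact: Sc.
by rewrite derive1_cst dotC => H; lra.
Qed.

Lemma tangent_space_sphere x v :
  dot x x = 1 -> tangent_space S x v <-> dot x v = 0.
Proof.
move=> xx; split=> [[c [cS <- <-]]|xv]; first exact: sphere_curve_orthogonal.
have [wv cS] := great_circle xx xv.
exists (circ (Num.sqrt (dot v v)) x ((Num.sqrt (dot v v))^-1 *: v)).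
split; first by split=> //; exact: smooth_circ.
- by rewrite circ0.
- by have [_ ->] := derive1_circ (Num.sqrt (dot v v)) x
    ((Num.sqrt (dot v v))^-1 *: v) 0; rewrite circ0.
Qed.

Lemma unit_tangent_bundle_sphere z : unit_tangent_bundle S z <->
  [/\ dot (lsubmx z) (lsubmx z) = 1, dot (lsubmx z) (rsubmx z) = 0 &
      dot (rsubmx z) (rsubmx z) = 1].
Proof.
split=> [[/= xx xv vv]|[xx xv vv]]; split=> //.
  by apply/tangent_space_sphere.
by apply/tangent_space_sphere.
Qed.

Lemma utb_mulmx (A : 'M[R]_m) z : A^T *m A = 1%:M ->
  unit_tangent_bundle S z -> unit_tangent_bundle S (A *m z).
Proof.
move=> AA /unit_tangent_bundle_sphere[xx xv vv].
apply/unit_tangent_bundle_sphere.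
by rewrite -mulmx_lsub -mulmx_rsub !dot_mulmx.
Qed.

Lemma row_mx_flow k (a b : 'M[R]_(k, 1)) t :
  row_mx a b *m flow_mx t =
  row_mx (cos t *: a + sin t *: b) (- sin t *: a + cos t *: b).
Proof. by rewrite /flow_mx mul_row_block !mul_mx_scalar. Qed.

Lemma geodesic_circ x v : dot x x = 1 -> dot x v = 0 -> dot v v = 1 ->
  geodesic S (circ 1 x v) /\
  forall t, velocity (circ 1 x v) t = row_mx x v *m flow_mx t.
Proof.
move=> xx xv vv; have [wv cS] := great_circle xx xv.
have Sc t : dot (circ 1 x v t) (circ 1 x v t) = 1.
  by have := cS t; rewrite vv sqrtr1 invr1 scale1r.
have dE a b : derive1 (circ 1 a b) = circ 1 b (- a) :> (R -> 'cV[R]_m).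
  by apply/funext => t; have [_ ->] := derive1_circ 1 a b t;
    rewrite scale1r scaleN1r.
split; last first.
  move=> t; rewrite row_mx_flow /velocity dE /circ mul1r.
  by rewrite scalerN -scaleNr (addrC (- sin t *: x)).
split=> [|t w]; first by split; [exact: smooth_circ|exact: Sc].
move/(tangent_space_sphere _ (Sc t)) => cw.
rewrite derive1nS derive1n1 !dE (_ : circ _ _ _ t = - 1 *: circ 1 x v t).
  by rewrite dotZl cw mulr0.
by rewrite /circ scaleN1r opprD !scalerN.
Qed.

(** The acceleration is normal, so the speed stays 1. Differentiating the orthogonality of [c] and
    its velocity then shows that the acceleration plus [c] is tangent; it is also normal, hence
    zero. Each coordinate is thus a harmonic oscillator. *)
Lemma velocity_geodesic (c : R -> 'cV[R]_m) t :
  geodesic S c -> dot (derive1 c 0) (derive1 c 0) = 1 ->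
  velocity c t = velocity c 0 *m flow_mx t.
Proof.
move=> [cS]; rewrite derive1nS derive1n1 => gc v0; have [sc Sc] := cS.
have dc s : derivable c s 1 := sc 0 s.
have ddc s : derivable (derive1 c) s 1 := sc 1%N s.
have o s : dot (c s) (derive1 c s) = 0 by exact: sphere_curve_orthogonal.
have o2 s : dot (derive1 c s) (derive1 c s) + dot (c s) (derive1 (derive1 c) s)
  = 0.
  have [_] := derive1_dot (dc s) (ddc s); move=> <-.
  rewrite (_ : (fun s => _) = cst 0); last by apply/funext => s'; exact: o.
  by rewrite derive1_cst.
have o3 s : dot (derive1 (derive1 c) s) (derive1 c s) = 0.
  by apply: gc; apply/(tangent_space_sphere _ (Sc s)).
have speed s : dot (derive1 c s) (derive1 c s) = 1.
  have d0 s' : is_derive s' (1 : R) (fun s => dot (derive1 c s) (derive1 c s))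
    0.
    have [d1 d2] := derive1_dot (ddc s') (ddc s'); split=> //.
    by rewrite -derive1E d2 o3 dotC o3 addr0.
  by rewrite (@is_derive_0_is_cst _ _ s 0 d0).
have c2 s : derive1 (derive1 c) s = - c s.
  apply/eqP; rewrite -subr_eq0 opprK; apply/eqP/dot_eq0.
  have cw : dot (c s) (derive1 (derive1 c) s + c s) = 0.
    by rewrite dotDr; have := o2 s; rewrite speed addrC (Sc s).
  by rewrite dotDl cw addr0; apply: gc; apply/(tangent_space_sphere _ (Sc s)).
have H i : c t i 0 = cos t * c 0 i 0 + sin t * derive1 c 0 i 0 /\
    derive1 c t i 0 = - sin t * c 0 i 0 + cos t * derive1 c 0 i 0.
  have d1 s := derive1_mxE i 0 (dc s); have d2 s := derive1_mxE i 0 (ddc s).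
  have dE : derive1 (fun s => c s i 0) = (fun s => derive1 c s i 0).
    by apply/funext => s; have [_] := d1 s.
  have := @harmonic_oscillator _ (fun s => c s i 0) t; rewrite dE; apply.
  - by move=> s; have [] := d1 s.
  - by move=> s; have [] := d2 s.
  - move=> s; rewrite derive1nS derive1n1 dE; have [_ ->] := d2 s.
    by rewrite c2 mxE.
rewrite /velocity row_mx_flow; congr row_mx; apply/matrixP => i j.
  by rewrite !ord1 !mxE; have [->] := H i.
by rewrite !ord1 !mxE; have [_ ->] := H i.
Qed.

End Sphere.

(** * Orbits of a finite cyclic group and the geodesic flow on the quotient *)

Section OrbitSpace.
Context {R : realType} {m : nat}.
Variables (T : 'M[R]_m) (q : nat).
Hypothesis T_orth : T^T *m T = 1%:M.
Hypothesis T_order : T ^+ q = 1.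
Hypothesis q_gt0 : (0 < q)%N.
Local Notation G := ([set T ^+ k | k in [set: nat]]).
Local Notation S := (unit_sphere R m).

Lemma powT_orth k : (T ^+ k)^T *m T ^+ k = 1%:M.
Proof.
elim: k => [|k IH]; first by rewrite expr0 trmx1 mul1mx.
by rewrite exprS -mulmxE trmx_mul -mulmxA (mulmxA T^T) T_orth mul1mx.
Qed.

(** The group is listed by nonnegative powers only, so inverses are expressed as powers too: the two
    exponents add up to [k * q]. *)
Lemma powTV k : T ^+ (k * q.-1) *m T ^+ k = 1%:M.
Proof.
by rewrite mulmxE -exprD -mulnSr prednK// mulnC exprM T_order expr1n.
Qed.

Lemma powT_mod k : T ^+ k = T ^+ (k %% q).
Proof.
by rewrite [in LHS](divn_eq k q) exprD mulnC exprM T_order expr1n mul1r.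
Qed.

Lemma orb_powT n k (z : 'M[R]_(m, n)) : orb G (T ^+ k *m z) = orb G z.
Proof.
apply/seteqP; split=> [_ [_ [j _ <-] <-]|_ [_ [j _ <-] <-]].
  exists (T ^+ (j + k)); first by exists (j + k)%N.
  by rewrite exprD -mulmxE mulmxA.
exists (T ^+ (j + k * q.-1)); first by exists (j + k * q.-1)%N.
by rewrite exprD -mulmxE -!mulmxA (mulmxA _ _ z) powTV mul1mx.
Qed.

Lemma orb_eqP n (y z : 'M[R]_(m, n)) :
  orb G y = orb G z <-> exists k : nat, y = T ^+ k *m z.
Proof.
split=> [yz|[k ->]]; last exact: orb_powT.
have : orb G y y by exists (T ^+ 0); [exists 0%N|rewrite expr0 mul1mx].
by rewrite yz => -[_ [k _ <-] <-]; exists k.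
Qed.

Lemma SM_orb z : SM S G (orb G z) <-> unit_tangent_bundle S z.
Proof.
split=> [[y Uy /esym/orb_eqP[k ->]]|Uz]; last by exists z.
exact: (utb_mulmx (powT_orth k)).
Qed.

(** The choice made by [xget] is forced. A great circle provides one value; any competing geodesic
    starts at some [T ^+ k *m z], has unit speed because [T] is orthogonal, and ends in the same
    orbit because left and right multiplications commute. *)
Lemma geodesic_flow_orb t z : unit_tangent_bundle S z ->
  geodesic_flow S G t (orb G z) = orb G (z *m flow_mx t).
Proof.
move=> Uz; apply: xget_subset1.
  have [xx xv vv] := (unit_tangent_bundle_sphere z).1 Uz.
  have [gc vc] := geodesic_circ xx xv vv.
  exists (circ 1 (lsubmx z) (rsubmx z)); split=> //; last by rewrite vc hsubmxK.
  rewrite vc hsubmxK; congr orb.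
  rewrite -[in LHS](hsubmxK z) row_mx_flow cos0 sin0.
  by rewrite oppr0 !scale0r !scale1r addr0 add0r hsubmxK.
suff E y : [set theta' | exists c : R -> 'cV[R]_m, [/\ geodesic S c,
    orb G (velocity c 0) = orb G z & orb G (velocity c t) = theta']] y ->
    y = orb G (z *m flow_mx t) by move=> y1 y2 /E -> /E ->.
move=> [c [gc /orb_eqP[k ck] <-]].
have c1 : dot (derive1 c 0) (derive1 c 0) = 1.
  have := utb_mulmx (powT_orth k) Uz; rewrite -ck.
  by move/unit_tangent_bundle_sphere; rewrite row_mxKl row_mxKr => -[].
by rewrite (velocity_geodesic t gc c1) ck -mulmxA orb_powT.
Qed.

End OrbitSpace.

(** * Level sets of polynomial submersions, and compactness *)

Section LevelSets.
Context {R : realType}.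

Lemma polymap_level_set m k c (g : 'M[R]_(m, k) -> 'cV[R]_c) :
  polymap g -> (g @^-1` [set 0] !=set0 -> (c <= m * k)%N) ->
  (forall z, g z = 0 -> forall w, exists v, 'D_v g z = w) ->
  closed (g @^-1` [set 0]) /\ exists d, submanifold d (g @^-1` [set 0]).
Proof.
move=> Pg cmk sub; split.
  apply: preimage_closed => [z _|]; first exact: polymap_continuous.
  exact: (accessible_closed_set1 (hausdorff_accessible (@norm_hausdorff _ _))).
(* The truncated subtraction is harmless: the condition on dimensions is only checked at a point [z]
   of the level set, which bounds [c]. *)
exists (m * k - c)%N => z gz.
exists c, setT, g; split.
- by rewrite subnK// cmk//; exists z.
- by split => //; exact: openT.
- exact: polymap_smooth.
- move=> w; have [v <-] := sub z gz w; exists v.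
  by rewrite deriveE//; exact: polymap_differentiable.
- by rewrite !setTI.
Qed.

Lemma polyfun_dot m (f g : 'M[R]_(m, 1 + 1) -> 'cV[R]_m) :
  polymap f -> polymap g -> polyfun (fun z => dot (f z) (g z)).
Proof. by move=> Pf Pg; apply: polyfun_sum => i; exact: polyfun_mul. Qed.

Lemma polymap_lsubmx m : polymap (@lsubmx R m 1 1).
Proof. by move=> i j; under eq_fun do rewrite mxE; exact: polyfun_coord. Qed.

Lemma polymap_rsubmx m : polymap (@rsubmx R m 1 1).
Proof. by move=> i j; under eq_fun do rewrite mxE; exact: polyfun_coord. Qed.

Lemma linear_sphere_level_set m (M : 'M[R]_(m * (1 + 1)))
    (A := [set z : 'M[R]_(m, 1 + 1) |
            mxvec z *m M = 0 /\ dot (lsubmx z) (lsubmx z) = 1]) :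
  closed A /\ exists d, submanifold d A.
Proof.
pose x (z : 'M[R]_(m, 1 + 1)) := lsubmx z.
(* The equations given by [M] may be dependent, which would prevent a submersion; [col_base M] keeps
   [\rank M] independent ones with the same solutions. *)
pose L (z : 'M[R]_(m, 1 + 1)) := (mxvec z *m col_base M)^T.
pose g z :=
  col_mx (L z) (const_mx (dot (x z) (x z) - 1)) : 'cV[R]_(\rank M + 1).
have LD h v z : L (h *: v + z) = h *: L v + L z.
  by rewrite /L linearP mulmxDl linearD -scalemxAl linearZ.
have L0 z : L z = 0 <-> mxvec z *m M = 0.
  rewrite -[X in _ *m X]mulmx_base mulmxA; split=> [|/eqP].
    by move/(congr1 trmx); rewrite trmxK trmx0 => ->; rewrite mul0mx.
  by rewrite mulmx_free_eq0 ?row_base_free// /L => /eqP ->; rewrite trmx0.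
have AE : A = g @^-1` [set 0].
  apply/seteqP; split=> z /=.
    move=> [/L0 Lz xz]; rewrite /g Lz /x xz subrr.
    by apply/colP => i; rewrite !mxE; case: splitP => j _; rewrite !mxE.
  rewrite /g -[0]vsubmxK => /eq_col_mx[]; rewrite linear0 => /L0 Lz.
  by move=> /matrixP/(_ 0 0); rewrite !mxE => /eqP; rewrite subr_eq0 => /eqP.
have gE z v h : g (h *: v + z) = g z +
    h *: col_mx (L v) (const_mx (2 * dot (x z) (x v))) +
    h ^+ 2 *: col_mx 0 (const_mx (dot (x v) (x v))).
  rewrite /g LD !scale_col_mx !add_col_mx; congr col_mx.
    by rewrite scaler0 addr0 addrC.
  apply/matrixP => i j; rewrite !mxE /x linearP.
  by rewrite !(dotDl, dotDr, dotZl, dotZr) (dotC (lsubmx z)); ring.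
rewrite AE; apply: polymap_level_set.
- move=> i j; rewrite ord1 /g; case: (split_ordP i) => i' ->.
    under eq_fun do rewrite col_mxEu mxE mxE.
    apply: polyfun_sum => l; case: (mxvec_indexP l) => a b.
    apply: polyfun_mul; last exact: polyfun_cst.
    by under eq_fun do rewrite mxvecE; exact: polyfun_coord.
  under eq_fun do rewrite col_mxEd mxE; apply: polyfun_add; last first.
    exact: polyfun_cst.
  by apply: polyfun_dot; exact: polymap_lsubmx.
(* If [M] had full row rank, its kernel would be zero and could not contain a point with a unit
   first column. *)
- rewrite -AE => -[z [zM zz]]; rewrite addn1 ltn_neqAle rank_leq_row andbT.
  apply/negP => Mfree; have : mxvec z == 0.
    by rewrite -(mulmx_free_eq0 _ Mfree) zM.
  rewrite mxvec_eq0 => /eqP z0; move: zz.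
  by rewrite z0 linear0 -(scale0r 0) dotZl mul0r => /esym/eqP; rewrite oner_eq0.
- move=> z gz w.
  have /= [/L0 Lz xz] : A z by rewrite AE.
  (* The vector [u] solves the linear equations. Adding a multiple of [z], which [L] kills, then
     adjusts the last coordinate, since the squared norm of the first column has derivative 2 at [z]
     in the direction [z]. *)
  have /submxP[u uE] : ((usubmx w)^T <= col_base M)%MS.
    by rewrite submx_full// col_base_full.
  pose s := dsubmx w 0 0 / 2 - dot (x z) (x (vec_mx u)).
  exists (s *: z + vec_mx u); rewrite (derive_quadratic (gE z _)).
  rewrite LD Lz scaler0 add0r /L vec_mxK -uE trmxK -[RHS]vsubmxK.
  congr col_mx; apply/matrixP => i j; rewrite !ord1 !mxE /x linearP.
  by rewrite dotDr dotZr xz /s !mxE /x; field.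
Qed.

Lemma utb_level_set m : (1 < m)%N ->
  closed (unit_tangent_bundle (unit_sphere R m)) /\
  exists d, submanifold d (unit_tangent_bundle (unit_sphere R m)).
Proof.
move=> m1.
pose col3 (a b c : R) : 'cV[R]_3 := \col_i [:: a; b; c]`_i.
pose x (z : 'M[R]_(m, 1 + 1)) := lsubmx z.
pose v (z : 'M[R]_(m, 1 + 1)) := rsubmx z.
pose g z := col3 (dot (x z) (x z) - 1) (dot (v z) (v z) - 1) (dot (x z) (v z)).
have AE : unit_tangent_bundle (unit_sphere R m) = g @^-1` [set 0].
  apply/seteqP; split=> z /=.
    move=> /unit_tangent_bundle_sphere[xx xv vv]; rewrite /g xx vv xv subrr.
    by apply/colP => i; rewrite !mxE; case: i => [[|[|[|]]]].
  move=> /colP gz; apply/unit_tangent_bundle_sphere.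
  have := (gz 0, gz 1, gz (inord 2)); rewrite !mxE inordK//= => -[[xx vv] xv].
  by split; rewrite // -?/(x z) -?/(v z); lra.
have gE z w h : g (h *: w + z) = g z +
    h *: col3 (2 * dot (x z) (x w)) (2 * dot (v z) (v w))
              (dot (x z) (v w) + dot (v z) (x w)) +
    h ^+ 2 *: col3 (dot (x w) (x w)) (dot (v w) (v w)) (dot (x w) (v w)).
  apply/colP => i; rewrite !mxE /x /v !linearP.
  rewrite !(dotDl, dotDr, dotZl, dotZr) (dotC (lsubmx z) (lsubmx w)).
  rewrite (dotC (rsubmx z)  (rsubmx w)) (dotC (lsubmx w) (rsubmx z)).
  by case: i => [[|[|[|]]]] //= _; ring.
rewrite AE; apply: polymap_level_set.
- have Pl := @polymap_lsubmx m; have Pr := @polymap_rsubmx m.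
  move=> i j; under eq_fun do rewrite mxE.
  case: i => [[|[|[|]]]] //= _.
  + by apply: polyfun_add; [exact: polyfun_dot|exact: polyfun_cst].
  + by apply: polyfun_add; [exact: polyfun_dot|exact: polyfun_cst].
  + exact: polyfun_dot.
- move=> _; rewrite addn1 muln2.
  by rewrite (leq_trans _ (_ : 2.*2 <= m.*2)%N)// leq_double.
- move=> z gz w; have /unit_tangent_bundle_sphere[xx xv vv] :
    unit_tangent_bundle (unit_sphere R m) z by rewrite AE.
  (* Rescaling the two columns moves the two norms independently, and adding a multiple of [x z] to
     the second column moves only the inner product. *)
  pose y := row_mx ((w 0 0 / 2) *: x z)
    ((w 1 0 / 2) *: v z + w (inord 2) 0 *: x z).
  have xy : x y = (w 0 0 / 2) *: x z by rewrite /x row_mxKl.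
  have vy : v y = (w 1 0 / 2) *: v z + w (inord 2) 0 *: x z.
    by rewrite /v row_mxKr.
  exists y; rewrite (derive_quadratic (gE z _)) xy vy.
  rewrite !(dotDr, dotZr) (dotC (v z) (x z)) xx xv vv.
  apply/colP => i; rewrite !mxE.
  have iE (j : 'I_3) : val i = j -> w i 0 = w j 0 by move=> /val_inj ->.
  case: i iE => [[|[|[|]]]] //= ? iE.
  + by rewrite (iE 0)//; field.
  + by rewrite (iE 1)//; field.
  + by rewrite (iE (inord 2)) ?inordK//; field.
Qed.

(** [A] is a closed subset of the continuous image under [vec_mx] of a compact cube of row
    vectors. *)
Lemma compact_entrywise_bounded m k (A : set 'M[R]_(m, k)) :
  closed A -> (forall z, A z -> forall i j, `|z i j| <= 1) -> compact A.
Proof.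
move=> Acl Abd.
pose B := [set v : 'rV[R]_(m * k) | forall i, `[-1, 1]%classic (v ord0 i)].
have Bc : compact B.
  apply: (@rV_compact _ _ (fun=> `[(-1 : R), 1]%classic)) => i.
  exact: segment_compact.
apply: (subclosed_compact Acl (B := vec_mx @` B)).
  apply: continuous_compact => //; apply: continuous_subspaceT.
  exact: linear_mx_continuous.
move=> z Az; exists (mxvec z); last exact: mxvecK.
move=> i; case: (mxvec_indexP i) => a b; rewrite mxvecE /= in_itv /= -ler_norml.
exact: Abd.
Qed.

Lemma utb_entry_bound m z :
  unit_tangent_bundle (unit_sphere R m) z -> forall i j, `|z i j| <= 1.
Proof.
have bound (u : 'cV[R]_m) i : dot u u = 1 -> `|u i 0| <= 1.
  move=> u1; rewrite -(@expr_le1 _ 2)// -normrX ger0_norm ?sqr_ge0//.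
  rewrite -u1 /dot (bigD1 i)//= -expr2 lerDl.
  by apply: sumr_ge0 => j _; rewrite -expr2 sqr_ge0.
move=> /unit_tangent_bundle_sphere[xx _ vv] i j.
by case: (split_ordP j) => a ->; rewrite ord1;
  [have := bound _ i xx|have := bound _ i vv]; rewrite mxE.
Qed.

End LevelSets.

(** * Cleanness of the quotient of a sphere by a free cyclic group *)

Section FreeCyclicAction.
Context {R : realType} {m : nat}.
Variables (T : 'M[R]_m) (q : nat).
Hypothesis T_orth : T^T *m T = 1%:M.
Hypothesis T_order : T ^+ q = 1.
Hypothesis q_gt0 : (0 < q)%N.
Hypothesis T_free : forall k (x : 'cV[R]_m),
  x != 0 -> T ^+ k *m x = x -> (q %| k)%N.
Hypothesis m_gt1 : (1 < m)%N.
Local Notation G := ([set T ^+ k | k in [set: nat]]).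
Local Notation S := (unit_sphere R m).
Local Notation U := (unit_tangent_bundle S).

Lemma utb_lsubmx_neq0 z : U z -> lsubmx z != 0.
Proof.
move=> /unit_tangent_bundle_sphere[xx _ _]; apply/eqP => x0; move: xx.
by rewrite x0 -(scale0r 0) dotZl mul0r => /esym/eqP; rewrite oner_eq0.
Qed.

Lemma powT_inj k l (x : 'cV[R]_m) : x != 0 -> T ^+ k *m x = T ^+ l *m x ->
  k = l %[mod q].
Proof.
(* This exponent stands for [l - k] modulo [q], so the corresponding power of [T] fixes [x]. *)
move=> x0 kl; have := T_free (k := k * q.-1 + l) x0.
rewrite exprD -mulmxE -mulmxA -kl mulmxA (powTV T_order q_gt0) mul1mx.
move=> /(_ erefl)/dvdnP[a aE].
have E : (k * q + l = a * q + k)%N.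
  by rewrite -aE -[X in (k * X + l)%N = _](prednK q_gt0) mulnS -addnA addnC.
by rewrite -(modnMDl k l) E modnMDl.
Qed.

Lemma powT_eq k l (x : 'cV[R]_m) : x != 0 -> T ^+ k *m x = T ^+ l *m x ->
  T ^+ k = T ^+ l.
Proof.
move=> x0 /(powT_inj x0) kl.
by rewrite (powT_mod T_order k) (powT_mod T_order l) kl.
Qed.

Lemma flow_eq_rows k tau z : T ^+ k *m z = z *m flow_mx tau ->
  T ^+ k *m lsubmx z = cos tau *: lsubmx z + sin tau *: rsubmx z /\
  T ^+ k *m rsubmx z = - sin tau *: lsubmx z + cos tau *: rsubmx z.
Proof.
by rewrite -{1 2}(hsubmxK z) mul_mx_row row_mx_flow => /eq_row_mx.
Qed.

(* [T ^+ k] preserves the Gram matrix of the columns of [z], and rotating the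
   columns by [tau] preserves it only if it is scalar. *)
Lemma flow_eq_conformal k tau z : sin tau != 0 ->
  T ^+ k *m z = z *m flow_mx tau ->
  dot (rsubmx z) (rsubmx z) = dot (lsubmx z) (lsubmx z) /\
  dot (lsubmx z) (rsubmx z) = 0.
Proof.
move=> s0 /flow_eq_rows; set x := lsubmx z; set v := rsubmx z => -[Tx Tv].
have := dot_mulmx x x (powT_orth T_orth k).
have := dot_mulmx x v (powT_orth T_orth k).
rewrite Tx Tv !(dotDl, dotDr, dotZl, dotZr) (dotC v x).
have := cos2Dsin2 tau; move: s0; move: (sin tau) (cos tau) => s c s0 cs.
move: (dot x x) (dot x v) (dot v v) => X P V e1 e2.
have h1 : s * (s * (X - V) - 2 * c * P) = 0.
  have csX : c ^+ 2 * X + s ^+ 2 * X = X by rewrite -mulrDl cs mul1r.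
  by rewrite expr2 in csX; rewrite expr2 in csX; lra.
have h2 : s * (2 * s * P + c * (X - V)) = 0.
  have csP : c ^+ 2 * P + s ^+ 2 * P = P by rewrite -mulrDl cs mul1r.
  by lra.
move/eqP: h1; rewrite mulf_eq0 (negPf s0)/= => /eqP h1.
move/eqP: h2; rewrite mulf_eq0 (negPf s0)/= => /eqP h2.
(* [h1] and [h2] are linear equations in [X - V] and [2 * P] whose matrix is a rotation; the
   combination with coefficients [s] and [c] isolates [X - V]. *)
have XV : X - V = 0.
  have -> : X - V = (c ^+ 2 + s ^+ 2) * (X - V) by rewrite cs mul1r.
  have : s * (s * (X - V) - 2 * c * P) + c * (2 * s * P + c * (X - V)) = 0.
    by rewrite h1 h2 !mulr0 addr0.
  by move=> <-; ring.
move: h2; rewrite XV mulr0 addr0 => /eqP.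
rewrite !mulf_eq0 (negPf s0) orbF pnatr_eq0/= => /eqP ->; split=> //.
by lra.
Qed.

(** By freeness a power of [T] is determined by its value at one nonzero vector, which settles
    [c = 1]. For [c = -1] the square of [T ^+ k] is 1, so [T ^+ k] fixes every vector in the image
    of [T ^+ k + 1]; a nonzero one would force [T ^+ k = 1], against its value at [x]. *)
Lemma powT_sign (c : R) k (x : 'cV[R]_m) : c = 1 \/ c = -1 -> x != 0 ->
  T ^+ k *m x = c *: x -> T ^+ k = c%:M.
Proof.
move=> [->|->] x0 Tx.
  rewrite -[RHS]/(T ^+ 0); apply: (powT_eq x0).
  by rewrite Tx expr0 mul1mx scale1r.
have Tkk : T ^+ k *m T ^+ k = 1%:M.
  rewrite mulmxE -exprD -[RHS]/(T ^+ 0); apply: (powT_eq x0).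
  rewrite exprD -mulmxE -mulmxA Tx -scalemxAr Tx expr0 mul1mx scalerA.
  by rewrite mulrNN mulr1 scale1r.
apply/eqP; rewrite -subr_eq0; apply/eqP/matrixP => i j.
pose w := (T ^+ k + 1%:M) *m delta_mx j 0 : 'cV[R]_m.
have Tw : T ^+ k *m w = T ^+ 0 *m w.
  by rewrite /w mulmxA mulmxDr Tkk mulmx1 addrC expr0 mul1mx.
have w0 : w = 0.
  apply/eqP/negPn/negP => w0; move: Tx.
  rewrite (powT_eq w0 Tw) expr0 mul1mx scaleN1r => /eqP.
  by rewrite -addr_eq0 -mulr2n -scaler_nat scaler_eq0 pnatr_eq0 (negPf x0).
have := congr1 (fun u : 'cV_m => u i 0) w0.
by rewrite /w -colE !mxE => <-; case: (i == j); rewrite ?mulr1n ?mulr0n; ring.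
Qed.

Lemma flow_eq_all k tau z : sin tau = 0 -> U z ->
  T ^+ k *m z = z *m flow_mx tau ->
  forall y : 'M[R]_(m, 1 + 1), T ^+ k *m y = y *m flow_mx tau.
Proof.
move=> s0 Uz /flow_eq_rows[]; rewrite s0 scale0r addr0 => Tx _ y.
have c1 : cos tau = 1 \/ cos tau = -1.
  have /eqP := cos2Dsin2 tau.
  by rewrite s0 expr0n addr0 sqrf_eq1 => /orP[]/eqP ->; [left|right].
rewrite (powT_sign c1 (utb_lsubmx_neq0 Uz) Tx) -[in RHS](hsubmxK y).
rewrite row_mx_flow s0 oppr0 !scale0r addr0 add0r -scale_row_mx hsubmxK.
exact: mul_scalar_mx.
Qed.

Definition fix_flow tau k : set 'M[R]_(m, 1 + 1) :=
  [set z | U z /\ T ^+ k *m z = z *m flow_mx tau].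

Lemma fixed_set_orb tau z : fixed_set S G tau (orb G z) <->
  exists k, fix_flow tau k z.
Proof.
split=> [[/(SM_orb T_orth T_order q_gt0) Uz]|[k [Uz Tz]]].
  rewrite (geodesic_flow_orb T_orth T_order q_gt0)//.
  by move=> /(orb_eqP T_order q_gt0)[k zk]; exists k; split.
split; first exact/(SM_orb T_orth T_order q_gt0).
rewrite (geodesic_flow_orb T_orth T_order q_gt0)// -Tz.
exact: (orb_powT T_order q_gt0).
Qed.

Lemma fix_flow_submanifold tau k :
  closed (fix_flow tau k) /\ exists d, submanifold d (fix_flow tau k).
Proof.
have [s0|s0] := eqVneq (sin tau) 0.
  have [->|/set0P[z [Uz Tz]]] := eqVneq (fix_flow tau k) set0.
    by split; [exact: closed0|exists 0%N].
  rewrite (_ : fix_flow tau k = U); first exact: utb_level_set.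
  by apply/seteqP; split=> [y []//|y Uy]; split=> //;
    exact: (flow_eq_all s0 Uz).
(* The fixed point equation becomes a homogeneous linear system on [mxvec z]. Only the norm of the
   first column has to be imposed besides, as [flow_eq_conformal] supplies the other two
   conditions. *)
pose M := lin_mx (mulmx (T ^+ k)) - lin_mx (mulmxr (flow_mx tau)).
rewrite (_ : fix_flow tau k = [set z : 'M[R]_(m, 1 + 1) |
    mxvec z *m M = 0 /\ dot (lsubmx z) (lsubmx z) = 1]).
  exact: linear_sphere_level_set.
have ME z : mxvec z *m M = 0 <-> T ^+ k *m z = z *m flow_mx tau.
  rewrite mulmxBr !mul_vec_lin -linearB /=; split=> [/eqP|->].
    by rewrite mxvec_eq0 subr_eq0 => /eqP.
  by rewrite subrr linear0.
apply/seteqP; split=> z /=.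
  by move=> [/unit_tangent_bundle_sphere[xx _ _] /ME].
move=> [/ME Tz xx]; split=> //; apply/unit_tangent_bundle_sphere.
by have [-> ->] := flow_eq_conformal s0 Tz.
Qed.

Definition fix_component tau (i : 'I_q) : set (set 'M[R]_(m, 1 + 1)) :=
  [set orb G z | z in fix_flow tau i].

(** Powers of [T] commute with each other, so [fix_flow tau i] is a union of orbits and hence the
    full preimage of its projection. *)
Lemma fix_component_orb tau i z :
  fix_component tau i (orb G z) <-> fix_flow tau i z.
Proof.
split=> [[y [Uy Ty] /esym/(orb_eqP T_order q_gt0)[k ->]]|]; last by exists z.
split; first exact: (utb_mulmx (powT_orth T_orth k)).
by rewrite -(mulmxA _ y) -Ty !mulmxA !mulmxE -!exprD addnC.
Qed.

Lemma fixed_set_components tau :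
  [/\ fixed_set S G tau = \bigcup_i fix_component tau i,
      trivIset setT (fix_component tau) &
      forall i, closed_submanifold S G (fix_component tau i)].
Proof.
split.
- apply/seteqP; split=> [theta Fth|_ [i _ [z zi <-]]]; last first.
    by apply/fixed_set_orb; exists i.
  have [[z Uz zE] _] := Fth; move: Fth; rewrite -zE.
  move=> /fixed_set_orb[k [_ Tz]].
  exists (Ordinal (ltn_pmod k q_gt0)) => //.
  by apply/fix_component_orb; split=> //; rewrite -Tz -(powT_mod T_order).
- move=> i j _ _ [_ [[z zi <-] /fix_component_orb[_ Tj]]].
  have [Uz Ti] := zi; apply/ord_inj.
  rewrite -(modn_small (ltn_ord i)) -(modn_small (ltn_ord j)).
  apply: (powT_inj (utb_lsubmx_neq0 Uz)).
  by rewrite !mulmx_lsub Ti Tj.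
- move=> i; split=> [_ [z [Uz _] <-]|];
    first exact/(SM_orb T_orth T_order q_gt0).
  have [Fcl Fsub] := fix_flow_submanifold tau i.
  rewrite (_ : [set z | _] = fix_flow tau i); last first.
    by apply/seteqP; split=> z /fix_component_orb.
  split=> //; apply: compact_entrywise_bounded => // z [Uz _].
  exact: utb_entry_bound.
Qed.

(* Two lifts to the unit tangent bundle of the same curve differ by a power of
   [T] that is locally constant, as the action is free. *)
Lemma velocity_lift (A : 'M[R]_(1 + 1)) (c e : R -> 'M[R]_(m, 1 + 1)) :
  (forall B : 'M[R]_(m, 1 + 1), U B -> U (B *m A)) ->
  curve_in U c -> smooth_curve e ->
  (forall t, exists k : nat, e t = T ^+ k *m (c t *m A)) ->
  exists k : nat, e 0 = T ^+ k *m (c 0 *m A) /\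
    derive1 e 0 = T ^+ k *m (derive1 c 0 *m A).
Proof.
move=> UA [sc Uc] se ce; have [k ek] := ce 0; exists k; split=> //.
have dc : derivable c 0 1 := sc 0 0; have de : derivable e 0 1 := se 0 0.
pose L (l : nat) : {linear 'M[R]_(m, 1 + 1) -> 'M[R]_(m, 1 + 1)} :=
  mulmx (T ^+ l) \o mulmxr A.
have eL : \forall t \near (0 : R), e t = L k (c t).
  (* There are finitely many candidates [j]. If [T ^+ j] differs from [T ^+ k], then [e] and
     [L j \o c] differ at 0 by freeness, hence near 0 by continuity. *)
  have : \forall t \near (0 : R), forall j : 'I_q,
      e t = L j (c t) -> T ^+ j = T ^+ k.
    apply: (@filter_forall _ _ (fun (j : 'I_q) (t : R) =>
      e t = L j (c t) -> T ^+ j = T ^+ k) (nbhs (0 : R))) => j.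
    have [->|Tjk] := eqVneq (T ^+ j) (T ^+ k); first by near=> t.
    have cont : {for 0, continuous (fun t => e t - L j (c t))}.
      apply: continuousB.
        exact/differentiable_continuous/derivable1_diffP.
      apply/differentiable_continuous/derivable1_diffP.
      by have [] := derivable_linear_mx (L j) dc.
    have : e 0 - L j (c 0) != 0.
      rewrite subr_eq0 ek; apply: contra Tjk => /eqP /= kj.
      apply/eqP/esym/(powT_eq (utb_lsubmx_neq0 (UA _ (Uc 0)))).
      by rewrite !mulmx_lsub kj.
    move=> /(cvgr_neq0 _ cont); apply: filterS => t /eqP + et.
    by rewrite et subrr.
  apply: filterS => t H; have [l el] := ce t; rewrite el /=.
  have := H (Ordinal (ltn_pmod l q_gt0)).
  by rewrite /= -(powT_mod T_order) => /(_ el) ->.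
have [_ dL] := derivable_linear_mx (L k) dc.
by rewrite derive1E (near_eq_derive _ eL) -derive1E dL.
Unshelve. all: by end_near. Qed.

(** Upstairs the flow is linear and so acts on foot points and on tangent vectors by the same
    matrix; the ambiguity in the lift [e] is a power of [T], which the orbit absorbs. *)
Lemma differential_flow tau (c e : R -> 'M[R]_(m, 1 + 1)) :
  curve_in U c -> smooth_curve e ->
  (forall t, orb G (e t) = geodesic_flow S G tau (orb G (c t))) ->
  orb G (velocity e 0) =
    orb G (row_mx (c 0 *m flow_mx tau) (derive1 c 0 *m flow_mx tau)).
Proof.
move=> cU se ce; apply/(orb_eqP T_order q_gt0).
have [||k [e0 de0]] := @velocity_lift (flow_mx tau) _ _ _ cU se.
- move=> B UB; rewrite -(hsubmxK B) row_mx_flow.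
  move: UB => /unit_tangent_bundle_sphere.
  set x := lsubmx B; set v := rsubmx B => -[xx xv vv].
  apply/unit_tangent_bundle_sphere; rewrite row_mxKl row_mxKr.
  rewrite !(dotDl, dotDr, dotZl, dotZr) (dotC v x) xx xv vv.
  by have := cos2Dsin2 tau => cs; split; rewrite -?[RHS]cs; ring.
- move=> t; apply/(orb_eqP T_order q_gt0).
  by rewrite ce (geodesic_flow_orb T_orth T_order q_gt0)//; exact: cU.2.
- by exists k; rewrite /velocity e0 de0 mul_mx_row.
Qed.

(** This is the heart of cleanness: a solution of the linearized equation is tangent to the fixed
    point set. If [sin tau = 0], the curve [c] itself stays in that set. Otherwise the curve through
    [z] with velocity [w] built from [circ] satisfies the linear equation throughout, and by
    [flow_eq_conformal] it suffices that its first column is a great circle. *)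
Lemma fix_flow_curve tau k (c : R -> 'M[R]_(m, 1 + 1)) :
  curve_in U c -> fix_flow tau k (c 0) ->
  T ^+ k *m derive1 c 0 = derive1 c 0 *m flow_mx tau ->
  exists e, curve_in (fix_flow tau k) e /\ velocity e 0 = velocity c 0.
Proof.
move=> cU; set z := c 0; set w := derive1 c 0 => -[Uz Tz] Tw.
have [s0|s0] := eqVneq (sin tau) 0.
  exists c; split=> //; split; first exact: cU.1.
  by move=> t; split; [exact: cU.2|exact: (flow_eq_all s0 Uz)].
have [[sc Uc] [xx xv vv]] := (cU, (unit_tangent_bundle_sphere z).1 Uz).
have dc : derivable c 0 1 := sc 0 0.
have xy : dot (lsubmx z) (lsubmx w) = 0.
  have [_ <-] := derivable_linear_mx (@lsubmx R m 1 1) dc.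
  have dx : derivable (fun t => lsubmx (c t)) 0 1.
    by have [] := derivable_linear_mx (@lsubmx R m 1 1) dc.
  have [_] := derive1_dot dx dx.
  rewrite (_ : (fun t => dot _ _) = cst 1); last first.
    by apply/funext => t; have /unit_tangent_bundle_sphere[] := Uc t.
  by rewrite derive1_cst dotC => H; rewrite /z; lra.
have [+ uc] := great_circle xx xy.
set r := Num.sqrt _ in uc *; move=> wy.
(* Here [r] is the norm of the first column of [w] only. If it vanishes, conformality makes the
   second column vanish too, so [w = 0] and the value of the inverse of 0 does not matter. *)
have wE : r *: (r^-1 *: w) = w.
  have [r0|r0] := eqVneq r 0; last by rewrite scalerA divff// scale1r.
  have y0 : lsubmx w = 0 by rewrite -wy r0 scale0r.
  have v0 : rsubmx w = 0.
    apply: dot_eq0; have [-> _] := flow_eq_conformal s0 Tw.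
    by rewrite y0 -(scale0r 0) dotZl mul0r.
  by rewrite -(hsubmxK w) y0 v0 row_mx0 !scaler0.
exists (circ r z (r^-1 *: w)); split; last first.
  have [_ de] := derive1_circ r z (r^-1 *: w) 0.
  by rewrite /velocity de !circ0 wE.
split=> [|t]; first exact: smooth_circ.
have Te : T ^+ k *m circ r z (r^-1 *: w) t =
  circ r z (r^-1 *: w) t *m flow_mx tau.
  by rewrite /circ mulmxDr mulmxDl -!scalemxAr -!scalemxAl Tz Tw.
split=> //; apply/unit_tangent_bundle_sphere.
have [-> ->] := flow_eq_conformal s0 Te.
suff -> : lsubmx (circ r z (r^-1 *: w) t) =
  circ r (lsubmx z) (r^-1 *: lsubmx w) t.
  by rewrite uc.
by apply/matrixP => i j; rewrite !mxE.
Qed.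

Lemma ker_differential_flow tau theta : fixed_set S G tau theta ->
  ker_differential_sub_id S G (geodesic_flow S G tau) theta =
  quotient_tangent_space G (fixed_set S G tau) theta.
Proof.
move=> Fth; apply/seteqP;
  split=> [X [[c0 [_ c0th c0X] dX]]|X [c [[sc Fc] cth cX]]].
  have [c [e [cU se ce cX eX]]] : exists c e : R -> 'M[R]_(m, 1 + 1),
      [/\ curve_in U c, smooth_curve e,
        (forall t, orb G (e t) = geodesic_flow S G tau (orb G (c t))),
        orb G (velocity c 0) = X & orb G (velocity e 0) = X].
    (* If no pair of curves existed, [xget] would return the default [set0], whereas [X] is an orbit
       and hence nonempty. *)
    move: dX; rewrite /differential; case: xgetP => [Y _ + YX|_ X0].
      by rewrite YX.
    have : X (velocity c0 0).
      by rewrite -c0X; exists (T ^+ 0); [exists 0%N|rewrite expr0 mul1mx].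
    by rewrite -X0.
  have [h] : exists h : nat, velocity c 0 = T ^+ h *m velocity c0 0.
    by apply/(orb_eqP T_order q_gt0); rewrite cX.
  rewrite /velocity mul_mx_row => /eq_row_mx[ch _].
  have cth : orb G (c 0) = theta by rewrite ch (orb_powT T_order q_gt0).
  (* Equality of orbits in the tangent bundle yields one power [k] that serves both the foot point
     and the vector: [c 0] lies in [fix_flow tau k], and its velocity solves the linearized equation
     for the same [k]. *)
  have := differential_flow cU se ce;
    rewrite eX -cX => /esym/(orb_eqP T_order q_gt0)[k].
  rewrite /velocity mul_mx_row => /eq_row_mx[zk wk].
  have [|d [[sd Fd] dv]] := fix_flow_curve (tau := tau) (k := k) cU _ (esym wk).
    by split=> //; exact: cU.2.
  have [d0 _] := eq_row_mx dv.
  exists d; split; [split=> // t|by rewrite d0|by rewrite dv].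
  by apply/fixed_set_orb; exists k.
have cU : curve_in U c.
  by split=> // t; have /fixed_set_orb[k []] := Fc t.
have ce t : orb G (c t) = geodesic_flow S G tau (orb G (c t)).
  by have [] := Fc t.
split.
  exists c; split=> //; split=> // t.
  by apply/(SM_orb T_orth T_order q_gt0); exact: cU.2.
(* A curve of fixed points is its own image under the flow, so [c] serves as both curves; uniqueness
   then comes from [differential_flow]. *)
apply: xget_subset1; first by exists c, c.
suff E Y : [set Y | exists c e : R -> 'M[R]_(m, 1 + 1),
    [/\ curve_in U c, smooth_curve e,
      (forall t, orb G (e t) = geodesic_flow S G tau (orb G (c t))),
      orb G (velocity c 0) = X & orb G (velocity e 0) = Y]] Y -> Y = X.
  by move=> Y1 Y2 /E -> /E ->.
move=> [c' [e' [cU' se' ce' cX' <-]]].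
rewrite (differential_flow cU' se' ce') -cX (differential_flow cU sc ce).
have [h] : exists h : nat, velocity c' 0 = T ^+ h *m velocity c 0.
  by apply/(orb_eqP T_order q_gt0); rewrite cX cX'.
rewrite /velocity mul_mx_row => /eq_row_mx[-> ->].
by rewrite -!mulmxA -mul_mx_row (orb_powT T_order q_gt0).
Qed.

Lemma clean_free_quotient : clean S G.
Proof.
move=> tau _; split; last exact: ker_differential_flow.
by exists q, (fix_component tau); exact: fixed_set_components.
Qed.

End FreeCyclicAction.

(** * Block rotations and freeness of the lens space action *)

Section LensSpace.
Context {R : realType}.

Lemma cos_sin_2piz (z : int) :
  cos (2 * pi * z%:~R) = 1 :> R /\ sin (2 * pi * z%:~R) = 0 :> R.
Proof.
have H (k : nat) : cos (2 * pi * k%:R) = 1 :> R /\ sin (2 * pi * k%:R) = 0 :> R.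
  elim: k => [|k [ck sk]]; first by rewrite mulr0 cos0 sin0.
  have -> : 2 * pi * k.+1%:R = 2 * pi * k%:R + pi *+ 2 :> R.
    by rewrite -natr1 -mulr_natl; ring.
  by rewrite cosD2pi sinD2pi.
case: z => k; first exact: H.
have [ck sk] := H k.+1.
by rewrite NegzE mulrNz mulrN cosN sinN ck sk oppr0.
Qed.

Lemma rotation_2piz (z : int) : rotation (2 * pi * z%:~R) = 1%:M :> 'M[R]_2.
Proof.
have [c s] := cos_sin_2piz z; rewrite /rotation c s oppr0.
by rewrite (scalar_mx_block 1 1) raddf0.
Qed.

Lemma rotationM (a b : R) : rotation a *m rotation b = rotation (a + b).
Proof.
(* [rotation] and [flow_mx] are convertible; the size [1 + 1] of the latter lets the block matrix
   lemmas apply. *)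
suff : flow_mx a *m flow_mx b = flow_mx (a + b) by [].
rewrite /flow_mx mulmx_block cosD sinD; congr block_mx;
  by rewrite -!scalar_mxM -raddfD; congr (_%:M); ring.
Qed.

Lemma tr_rotation (a : R) : (rotation a)^T = rotation (- a).
Proof.
suff : (flow_mx a)^T = flow_mx (- a) by [].
by rewrite /flow_mx tr_block_mx !tr_scalar_mx cosN sinN opprK.
Qed.

(** A vector fixed by a rotation is fixed by its inverse as well, and the sum of the two rotations
    is the scalar [2 * cos a]. *)
Lemma rotation_fixed (a : R) (y : 'cV[R]_2) :
  y != 0 -> rotation a *m y = y -> cos a = 1.
Proof.
move=> y0 ay.
have r0 : rotation 0 = 1%:M :> 'M[R]_2.
  by have := rotation_2piz 0; rewrite mulr0.
have Nay : rotation (- a) *m y = y.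
  by rewrite -{1}ay mulmxA rotationM addNr r0 mul1mx.
have rD : rotation a + rotation (- a) = (2 * cos a)%:M :> 'M[R]_2.
  suff : flow_mx a + flow_mx (- a) = (2 * cos a)%:M by [].
  rewrite /flow_mx add_block_mx (scalar_mx_block 1 1) cosN sinN.
  by congr block_mx; rewrite -raddfD ?subrr ?addNr ?raddf0//; congr (_%:M);
    ring.
have : (2 * cos a - 2) *: y = 0.
  by rewrite scalerBl -mul_scalar_mx -rD mulmxDl ay Nay scaler_nat mulr2n subrr.
by move=> /eqP; rewrite scaler_eq0 (negPf y0) orbF => /eqP; lra.
Qed.

(** Only the remainder of [z] modulo [q] affects the cosine. Half the remaining angle, [a], lies in
    the interval from 0 to [pi], with [pi] excluded, and [cos (a *+ 2) = 1] gives [sin a = 0]; a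
    positive remainder would make [sin a] positive. *)
Lemma cos_eq1_dvdz (q : nat) (z : int) : (0 < q)%N ->
  cos (2 * pi * z%:~R / q%:R) = 1 :> R -> (q%:Z %| z)%Z.
Proof.
move=> q0 cz; have qR0 : (q%:R : R) != 0 by rewrite pnatr_eq0 -lt0n.
have qR_gt0 : (0 : R) < q%:R by rewrite ltr0n.
have r_ge0 : (0 <= z %% q)%Z by rewrite modz_ge0// -lt0n.
have r_lt : (z %% q < q)%Z by rewrite ltz_pmod.
have [c s] := cos_sin_2piz (z %/ q)%Z.
pose a : R := pi * (z %% q)%Z%:~R / q%:R.
have : cos (a *+ 2) = 1.
  rewrite -cz [in RHS](divz_eq z q) intrD intrM -[in RHS]pmulrn.
  rewrite (_ : _ / _ = 2 * pi * (z %/ q)%Z%:~R + a *+ 2).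
    by rewrite [RHS]cosD c s mul1r mul0r subr0.
  by rewrite /a -mulr_natl; field.
rewrite cos_mulr2n => ca.
have sa : sin a = 0 by apply/eqP; rewrite -sqrf_eq0 sin2cos2; apply/eqP; lra.
apply/dvdz_mod0P/eqP/negPn/negP => r0.
have r_gt0 : (0 < z %% q)%Z by rewrite lt_neqAle eq_sym r0.
suff : 0 < sin a by rewrite sa ltxx.
apply: sin_gt0_pi; rewrite /a divr_gt0 ?mulr_gt0 ?pi_gt0 ?ltr0z//=.
rewrite ltr_pdivrMr// ltr_pM2l ?pi_gt0//.
by rewrite pmulrn ltr_int.
Qed.

Context {n : nat}.

(** Arbitrary angles make the family stable under products, transposes and powers, which become
    operations on angles; [lens_generator] is an instance. *)
Definition rotations (f : 'I_n -> R) : 'M[R]_(\sum_(i < n) 2) :=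
  \mxdiag_(i < n) rotation (f i).

Lemma rotationsM f g :
  rotations f *m rotations g = rotations (fun i => f i + g i).
Proof.
rewrite /rotations [X in _ *m X]/mxdiag mul_mxdiag_mxblock.
apply/eq_mxblock => i j; case: eqVneq => [->|_]; last exact: mulmx0.
by rewrite !conform_mx_id rotationM.
Qed.

Lemma tr_rotations f : (rotations f)^T = rotations (fun i => - f i).
Proof.
by rewrite /rotations tr_mxdiag; apply: eq_mxdiag => i; exact: tr_rotation.
Qed.

Lemma rotations_2piz (z : 'I_n -> int) :
  rotations (fun i => 2 * pi * (z i)%:~R) = 1%:M.
Proof.
by rewrite -mxdiagZ; apply: eq_mxdiag => i; exact: rotation_2piz.
Qed.

Lemma rotationsX f k : rotations f ^+ k = rotations (fun i => k%:R * f i).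
Proof.
elim: k => [|k IH].
  rewrite expr0; apply: (etrans (esym (rotations_2piz (fun=> 0)))).
  by apply: eq_mxdiag => i; rewrite mulr0 mul0r.
rewrite exprS IH -mulmxE rotationsM; apply: eq_mxdiag => i.
by rewrite -natr1; congr rotation; ring.
Qed.

Lemma rotations_fixed f (x : 'cV[R]_(\sum_(i < n) 2)) :
  x != 0 -> rotations f *m x = x -> exists i, cos (f i) = 1.
Proof.
move=> x0 fx.
have [i xi] : exists i, submxcol x i != 0.
  apply/existsP; apply: contraNT x0 => /existsPn xi.
  rewrite -(submxcolK x); apply/eqP; rewrite -[RHS]mxcol0.
  by apply/eq_mxcol => i; apply/eqP/negPn/xi.
exists i; apply: (rotation_fixed xi); move: fx.
rewrite -[in LHS](submxcolK x) mul_mxdiag_mxcol -[RHS](submxcolK x).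
by move/eq_mxcolP.
Qed.

End LensSpace.

Theorem theorem2 (R : realType) (n : nat) (n_gt0 : (0 < n)%N)
    (q : nat) (q_gt2 : (2 < q)%N) (p : 'I_n -> int)
    (p1 : p (Ordinal n_gt0) = 1)
    (pq_coprime : forall i, coprimez (p i) q%:Z) :
  clean (unit_sphere R (\sum_(i < n) 2)) (lens_group R q p).
Proof.
have q_gt0 : (0 < q)%N by exact: ltn_trans q_gt2.
have qR0 : (q%:R : R) != 0 by rewrite pnatr_eq0 -lt0n.
pose f i : R := 2 * pi * (p i)%:~R / q%:R.
apply: (@clean_free_quotient R _ (rotations f) q) => //.
- rewrite tr_rotations rotationsM -(rotations_2piz (fun=> 0));
    apply: eq_mxdiag => i.
  by rewrite addNr mulr0.
- rewrite rotationsX; apply: (etrans _ (rotations_2piz p)).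
  by apply: eq_mxdiag => i; congr rotation; rewrite /f; field.
(* Freeness: a nonzero fixed vector has a nonzero block [i], on which the rotation is trivial; hence
   [q] divides [k * p i], and [k] by coprimality. *)
- move=> k x x0; rewrite rotationsX => /(rotations_fixed x0)[i].
  rewrite (_ : _ * f i = 2 * pi * (k%:Z * p i)%:~R / q%:R).
    move/(cos_eq1_dvdz q_gt0).
    by rewrite Gauss_dvdzl 1?coprimez_sym.
  by rewrite intrM /f; ring.
- rewrite sum_nat_const card_ord muln2.
  by rewrite (leq_trans _ (_ : 1.*2 <= n.*2)%N)// leq_double.
Qed.
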